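(* Let $d,q\in\mathbb{N}$ (both $\ge 1$), let $m_1,\dots,m_d\ge 2$ be integers, let $M=\mathrm{diag}(m_1,\dots,m_d)$, and let $\mathbf{p}=\{\mathrm{p}(\boldsymbol{\alpha})\in\mathbb{R} : \boldsymbol{\alpha}\in\mathbb{Z}^d\}$ be a finitely supported real mask (defining a subdivision scheme $S_{\mathbf{p}}$ with dilation $M$) with symbol $p(\mathbf{z})=\sum_{\boldsymbol{\alpha}\in\mathbb{Z}^d}\mathrm{p}(\boldsymbol{\alpha})\mathbf{z}^{\boldsymbol{\alpha}}$, $\mathbf{z}\in(\mathbb{C}\setminus\{0\})^d$. Assume that (i) $D^{\boldsymbol{\mu}}p(\boldsymbol{\varepsilon})=0$ for all $\boldsymbol{\varepsilon}\in E_M\setminus\{\mathbf{1}\}$ and all $\boldsymbol{\mu}\in\mathbb{N}_0^d$ with $|\boldsymbol{\mu}|\le 2q-1$; (ii) $p(\mathbf{1})=|\det M|=\prod_{i=1}^d m_i$. Then the associated trigonometric polynomial $\hat p(\mathbf{x}):=p(e^{-\mathrm{i}x_1},\dots,e^{-\mathrm{i}x_d})$, $\mathbf{x}\in\mathbb{R}^d$, satisfies (a) for every $\mathbf{y}=(y_1,\dots,y_d)\in\mathbb{Q}^d\setminus\{\mathbf{0}\}$ with $y_i\in\{0,\frac{1}{m_i},\dots,\frac{m_i-1}{m_i}\}$ for $i=1,\dots,d$, $$\limsup_{\mathbf{x}\in\mathbb{R}^d,\ \|\mathbf{x}\|\to 0}\frac{|\hat p(\mathbf{x}+2\pi\mathbf{y})|}{\|\mathbf{x}\|^{2q}}<\infty;$$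 (b) $$\limsup_{\mathbf{x}\in\mathbb{R}^d,\ \|\mathbf{x}\|\to 0}\frac{\left|\hat p(\mathbf{x})-\prod_{i=1}^d m_i\right|}{\|\mathbf{x}\|}<\infty.$$
   Context: For $\boldsymbol{\alpha}\in\mathbb{Z}^d$, $\mathbf{z}^{\boldsymbol{\alpha}}=z_1^{\alpha_1}\cdots z_d^{\alpha_d}$. The set $E_M$ is $E_M=\{(e^{-2\pi\mathrm{i}\gamma_1/m_1},\dots,e^{-2\pi\mathrm{i}\gamma_d/m_d}) : \gamma_i\in\{0,\dots,m_i-1\},\ i=1,\dots,d\}$, and $\mathbf{1}=(1,\dots,1)$. For $\boldsymbol{\mu}\in\mathbb{N}_0^d$, $D^{\boldsymbol{\mu}}$ denotes the partial derivative $\partial^{|\boldsymbol{\mu}|}/\partial z_1^{\mu_1}\cdots\partial z_d^{\mu_d}$ and $|\boldsymbol{\mu}|=\mu_1+\dots+\mu_d$. The subdivision scheme $S_{\mathbf{p}}$ with dilation $M$ and mask $\mathbf{p}$ is the iteration $\mathbf{c}^{(k+1)}=\mathcal{S}_{\mathbf{p}}\mathbf{c}^{(k)}$ with $(\mathcal{S}_{\mathbf{p}}\mathbf{c})(\boldsymbol{\alpha})=\sum_{\boldsymbol{\beta}\in\mathbb{Z}^d}\mathrm{p}(\boldsymbol{\alpha}-M\boldsymbol{\beta})\mathrm{c}(\boldsymbol{\beta})$. Limits superior are taken over $\mathbf{x}\ne\mathbf{0}$. *)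

(* Defs.v *)
From HB Require Import structures.
From mathcomp Require Import all_boot all_order all_algebra finmap.
From mathcomp Require Import complex.
From mathcomp Require Import all_classical all_reals all_analysis.

Set Implicit Arguments.
Unset Strict Implicit.
Unset Printing Implicit Defensive.

Import Order.TTheory GRing.Theory Num.Theory.
Import numFieldNormedType.Exports.

Local Open Scope classical_set_scope.
Local Open Scope ring_scope.
Local Open Scope complex_scope.

Definition expi (R : realType) (t : R) : R[i] := cos t +i* sin t.

(* MathComp's norm on row vectors is the sup norm; this is the Euclidean one. *)
Definition enorm (R : realType) (d : nat) (x : 'rV[R]_d) : R :=
  Num.sqrt (\sum_(i < d) x 0 i ^+ 2).

Definition dilation (d : nat) (m : 'I_d -> nat) : 'M[int]_d :=
  diag_mx (\row_i (m i)%:Z).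

Definition monom (K : numFieldType) (d : nat) (a : 'rV[int]_d) (z : 'rV[K]_d) : K :=
  \prod_(i < d) z 0 i ^ a 0 i.

(* As a total function: at points with a zero coordinate, outside the domain
   of the Laurent polynomial, the value relies on the convention 0^-1 = 0.
   This does not affect values or derivatives on the open set (C \ {0})^d. *)
Definition symbol (R : realType) (d : nat)
    (p : {fsfun 'rV[int]_d -> R with 0}) (z : 'rV[R[i]]_d) : R[i] :=
  \sum_(a <- finsupp p) (p a)%:C * monom a z.

Definition trig_symbol (R : realType) (d : nat)
    (p : {fsfun 'rV[int]_d -> R with 0}) (x : 'rV[R]_d) : R[i] :=
  symbol p (\row_i expi (- x 0 i)).

Definition partial (K : numFieldType) (d : nat) (i : 'I_d)
    (f : 'rV[K]_d -> K) : 'rV[K]_d -> K :=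
  fun z => 'D_(delta_mx 0 i) f z.

(* d^|mu| f / dz_1^mu_1 ... dz_d^mu_d; the last coordinate is differentiated
   first. For K = R[i] these are complex derivatives. *)
Definition mpartial (K : numFieldType) (d : nat) (mu : 'I_d -> nat)
    (f : 'rV[K]_d -> K) : 'rV[K]_d -> K :=
  foldr (fun i g => iter (mu i) (partial i) g) f (enum 'I_d).

Definition E_M (R : realType) (d : nat) (m : 'I_d -> nat) : set 'rV[R[i]]_d :=
  [set eps | exists2 g : 'I_d -> nat, (forall i, (g i < m i)%N) &
     eps = \row_i expi (- (2 * pi * (g i)%:R / (m i)%:R))].

Definition limsup_at0 (R : realType) (d : nat) (f : 'rV[R]_d -> R) : \bar R :=
  limf_esup (fun x => (f x)%:E) (0 : 'rV[R]_d)^'.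

(* Main.v *)
Require Import Defs.
From HB Require Import structures.
From mathcomp Require Import all_boot all_order all_algebra finmap.
From mathcomp Require Import complex ring lra.
From mathcomp Require Import all_classical all_reals all_analysis.

Set Implicit Arguments.
Unset Strict Implicit.
Unset Printing Implicit Defensive.

Import Order.TTheory GRing.Theory Num.Theory.
Import numFieldNormedType.Exports.

Local Open Scope classical_set_scope.
Local Open Scope ring_scope.
Local Open Scope complex_scope.

Import Normc.

(** The trigonometric polynomial is a finite exponential sum.  Write a for the
    exponents of the mask and [eps] for the point of the torus with
    coordinates exp(-2 pi i y_j); then the symbol at x + 2 pi y equals
    [sum_a c_a exp(-i <a,x>)] with [c_a = p(a) eps^a].

    Such a sum is O(|x|^n) as soon as its moments [sum_a c_a <a,x>^k] vanish for
    every k < n.  To see this, restrict it to the segment from 0 to x: for the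
    function t |-> sum_a c_a exp(-i t <a,x>), the moments are, up to powers of
    -i, its derivatives at t = 0, and the n-th derivative is bounded on [0,1] by
    [sum_a |c_a| |<a,x>|^n], which is at most a constant times |x|^n.  Applying
    the mean value theorem n times carries this bound down to the function
    itself ([normc_exp_sum_le]).

    The hypothesis on the derivatives of the symbol gives these moments.
    Since D^mu z^a is the product of the falling factorials
    a_i (a_i - 1) ... (a_i - mu_i + 1) times z^(a - mu), and eps has no zero
    coordinate, D^mu p(eps) = 0 says that the sum of the c_a against these
    factorials vanishes ([mpartial_laurent], [mfallz_moments_eq0]).  Passing from
    falling factorials to powers of <a,x> is triangular, hence the moments of
    order below 2q vanish ([moments_eq0]).

    Part (b) is the same estimate with n = 1: subtracting the constant p(1),
    which is one more exponential term, of frequency 0, makes the moment of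
    order 0 vanish. *)

(** * Exponential sums with vanishing moments *)

(** Descending Taylor estimate: by the mean value theorem on [0, t] with t <= 1,
    a bound on a derivative bounds any primitive vanishing at 0.  The successive
    derivatives are passed as a family, so no iterated derivative operator
    occurs. *)
Lemma ler_norm_of_iterated_derivatives (R : realType) (n : nat)
    (G : nat -> R -> R) (A : R) :
  (forall k (t : R), (k < n)%N -> is_derive t 1 (G k) (G k.+1 t)) ->
  (forall k, (k < n)%N -> G k 0 = 0) ->
  (forall t, 0 <= t <= 1 -> `|G n t| <= A) ->
  forall t, 0 <= t <= 1 -> `|G 0%N t| <= A.
Proof.
elim: n G => [//|n IH] G dG G0 Gn t /andP[t0 t1].
have G1 : forall u, 0 <= u <= 1 -> `|G 1%N u| <= A.
  by apply: (IH (fun k => G k.+1)) => // k *; [exact: dG|exact: G0].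
have [//||c] := @MVT_segment R (G 0%N) (G 1%N) 0 t t0.
- by move=> x _; exact: dG.
- apply: derivable_within_continuous => x _.
  exact: (@ex_derive _ _ _ _ _ _ _ (dG 0%N x isT)).
rewrite in_itv/= => /andP[c0 ct]; rewrite G0// !subr0 => ->.
have c01 : 0 <= c <= 1 by rewrite c0 (le_trans ct).
rewrite normrM (ger0_norm t0) (le_trans _ (G1 c c01))//.
by rewrite ler_piMr.
Qed.

Lemma expi0 (R : realType) : expi (0 : R) = 1.
Proof. by rewrite /expi cos0 sin0. Qed.

Lemma expiD (R : realType) (s t : R) : expi (s + t) = expi s * expi t.
Proof.
rewrite /expi cosD sinD; simpc.
by congr (_ +i* _); rewrite addrC// [X in X + _]mulrC.
Qed.

Lemma expi_neq0 (R : realType) (t : R) : expi t != 0.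
Proof.
apply/eqP => e0; have := expiD t (- t).
by rewrite subrr expi0 e0 mul0r => /eqP; rewrite oner_eq0.
Qed.

Lemma expi_sum (R : realType) (I : Type) (r : seq I) (f : I -> R) :
  expi (\sum_(i <- r) f i) = \prod_(i <- r) expi (f i).
Proof. exact: (big_morph _ (@expiD R) (@expi0 R)). Qed.

Lemma expiXz (R : realType) (t : R) (b : int) : expi t ^ b = expi (b%:~R * t).
Proof.
have expN (n : nat) : expi t ^+ n = expi (n%:R * t).
  elim: n => [|n IH]; first by rewrite mul0r expi0.
  by rewrite exprS IH -expiD -natr1 mulrDl mul1r addrC.
case: b => n; first by rewrite -exprnP expN.
rewrite NegzE -exprnN expN; apply: (mulfI (expi_neq0 (n.+1%:R * t))).
by rewrite divff ?expi_neq0// -expiD rmorphN/= mulNr subrr expi0.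
Qed.

Lemma normc_expi (R : realType) (t : R) : normc (expi t) = 1.
Proof. by rewrite /= cos2Dsin2 sqrtr1. Qed.

Lemma normc_real (R : realType) (t : R) : normc t%:C = `|t|.
Proof. by rewrite /= expr0n/= addr0 sqrtr_sqr. Qed.

Lemma ler_normc_ReIm (R : realType) (z : R[i]) :
  normc z <= `|complex.Re z| + `|complex.Re (- 'i%C * z)|.
Proof.
case: z => a b; rewrite /=.
rewrite -[leRHS]ger0_norm ?addr_ge0// -sqrtr_sqr ler_wsqrtr//.
rewrite oppr0 mul0r sub0r mulN1r opprK.
rewrite sqrrD !real_normK ?num_real//.
by rewrite [leRHS]addrAC lerDl mulrn_wge0// mulr_ge0.
Qed.

Lemma ler_Re_normc (R : realType) (z : R[i]) : `|complex.Re z| <= normc z.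
Proof.
by case: z => a b /=; rewrite -sqrtr_sqr ler_wsqrtr// lerDl sqr_ge0.
Qed.

Lemma Re_sum (R : realType) (I : Type) (r : seq I) (F : I -> R[i]) :
  complex.Re (\sum_(j <- r) F j) = \sum_(j <- r) complex.Re (F j).
Proof.
apply: (big_morph (@complex.Re R) (id1 := 0) (op1 := +%R)) => //.
by move=> [a b] [a' b'].
Qed.

Lemma is_derive_Re_expi (R : realType) (c : R[i]) (s t : R) :
  is_derive t 1 (fun u => complex.Re (c * expi (u * s)))
    (complex.Re (c * ('i%C * s%:C) * expi (t * s))).
Proof.
case: c => a b.
have -> : (fun u => complex.Re ((a +i* b) * expi (u * s))) =
    (fun u => a * cos (u * s) - b * sin (u * s)).
  by apply/funext => u; rewrite /expi; simpc.
have dl : is_derive t 1 (fun u : R => u * s) s.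
  apply: (is_derive_eq (is_deriveM (is_derive_id t 1) (is_derive_cst s t 1))).
  by rewrite scaler0 add0r; exact: mulr1.
have dcos := @is_derive1_comp R cos (fun u => u * s) t _ _
  (is_derive_cos (t * s)) dl.
have dsin := @is_derive1_comp R sin (fun u => u * s) t _ _
  (is_derive_sin (t * s)) dl.
apply: (is_derive_eq (is_deriveB (is_deriveZ a dcos) (is_deriveZ b dsin))).
rewrite /= /GRing.scale/=; ring.
Qed.

(** An exponential sum whose moments of order below n vanish is controlled by its
    absolute moment of order n.  The real and imaginary parts are estimated
    separately, which costs the factor 2 and lets the real mean value theorem
    apply. *)
Lemma normc_exp_sum_le (R : realType) (I : Type) (r : seq I) (c : I -> R[i])
    (s : I -> R) (n : nat) :
  (forall k, (k < n)%N -> \sum_(j <- r) c j * (s j)%:C ^+ k = 0) ->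
  normc (\sum_(j <- r) c j * expi (s j)) <=
    (\sum_(j <- r) normc (c j) * `|s j| ^+ n) *+ 2.
Proof.
move=> c0; set A := (X in X *+ 2).
(* Rotating by a unit complex e treats the real part (e = 1) and the imaginary
   part (e = -i) at once. *)
suff H (e : R[i]) : normc e = 1 ->
    `|complex.Re (e * \sum_(j <- r) c j * expi (s j))| <= A.
  rewrite (le_trans (ler_normc_ReIm _))// mulr2n lerD//.
    by rewrite -[X in complex.Re X]mul1r H// normc1.
  by rewrite H// /= oppr0 expr0n add0r sqrrN expr1n sqrtr1.
move=> e1.
(* G k is the k-th derivative in t of the rotated sum restricted to a line. *)
pose G k t := \sum_(j <- r)
  complex.Re (e * c j * ('i%C * (s j)%:C) ^+ k * expi (t * s j)).
have -> : complex.Re (e * \sum_(j <- r) c j * expi (s j)) = G 0%N 1.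
  rewrite mulr_sumr Re_sum; apply: eq_bigr => j _.
  by rewrite expr0 mulr1 mul1r mulrA.
apply: (@ler_norm_of_iterated_derivatives R n G); last by rewrite ler01 lexx.
- move=> k t _; rewrite /G.
  elim: (r) => [|j r' IH].
    rewrite big_nil; under eq_fun do rewrite big_nil.
    exact: is_derive_cst.
  rewrite big_cons; under eq_fun do rewrite big_cons.
  have D := is_derive_Re_expi (e * c j * ('i%C * (s j)%:C) ^+ k) (s j) t.
  apply: (is_derive_eq (is_deriveD D IH)).
  by rewrite [in RHS]exprSr [in RHS]mulrA.
- move=> k kn; rewrite /G -Re_sum.
  rewrite [X in complex.Re X](_ : _ = 0)//.
  under eq_bigr => j _ do rewrite mul0r expi0 mulr1 exprMn.
  transitivity (e * 'i%C ^+ k * \sum_(j <- r) c j * (s j)%:C ^+ k); last first.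
    by rewrite c0// mulr0.
  rewrite mulr_sumr.
  by apply: eq_bigr => j _; rewrite mulrACA.
- move=> t _; rewrite (le_trans (ler_norm_sum _ _ _))//.
  apply: ler_sum => j _; rewrite (le_trans (ler_Re_normc _))//.
  rewrite !normcM normc_expi mulr1 e1 mul1r ler_wpM2l//.
    by case: (c j) => x y; exact: sqrtr_ge0.
  have normcX (z : R[i]) : normc (z ^+ n) = normc z ^+ n.
    by elim: (n) => [|m IHm]; rewrite ?normc1// !exprS normcM IHm.
  rewrite normcX normcM normc_real.
  by rewrite /= expr0n add0r expr1n sqrtr1 mul1r.
Qed.

(** * From falling factorials to powers *)

(** The falling factorial b (b - 1) ... (b - k + 1), with b possibly negative. *)
Definition fallz (b : int) (k : nat) : int := \prod_(j < k) (b - j%:Z).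

Definition mfallz (d : nat) (a : 'rV[int]_d) (mu : 'I_d -> nat) : int :=
  \prod_(i < d) fallz (a 0 i) (mu i).

Definition incr_index (d : nat) (mu : 'I_d -> nat) (i : 'I_d) : 'I_d -> nat :=
  fun j => (mu j + (j == i))%N.

Lemma mfallz0 (d : nat) (a : 'rV[int]_d) : mfallz a (fun=> 0%N) = 1.
Proof. by apply: big1 => i _; rewrite /fallz big_ord0. Qed.

Lemma mfallz_incr (d : nat) (a : 'rV[int]_d) (mu : 'I_d -> nat) (i : 'I_d) :
  mfallz a (incr_index mu i) = mfallz a mu * (a 0 i - (mu i)%:Z).
Proof.
rewrite /mfallz (bigD1 i)//= [in RHS](bigD1 i)//= /incr_index eqxx addn1.
rewrite {1}/fallz big_ord_recr/= -/(fallz _ _) mulrAC; congr (_ * _ * _).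
by apply: eq_bigr => j ji; rewrite (negbTE ji) addn0.
Qed.

Lemma sum_incr_index (d : nat) (mu : 'I_d -> nat) (i : 'I_d) :
  (\sum_(j < d) incr_index mu i j = (\sum_(j < d) mu j).+1)%N.
Proof.
rewrite big_split/= -[RHS]addn1; congr (_ + _)%N.
by rewrite (bigD1 i)//= eqxx big1// => j /negbTE ->.
Qed.

(** The factor (b_i - mu_i) raises the i-th index of the falling factorial, so
    multiplying by <b, x> = sum_i x_i ((b_i - mu_i) + mu_i) expresses the moment
    weighted by index mu through the weights mu + e_i and mu with one factor
    <b, x> fewer.  Induction on the number of such factors, with mu
    generalized, avoids writing the triangular change of basis explicitly. *)
Lemma moments_eq0 (K : comPzRingType) (d N : nat) (I : Type) (r : seq I)
    (b : I -> 'rV[int]_d) (c : I -> K) (x : 'I_d -> K) :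
  (forall mu : 'I_d -> nat, (\sum_(i < d) mu i <= N)%N ->
     \sum_(j <- r) c j * (mfallz (b j) mu)%:~R = 0) ->
  forall k, (k <= N)%N ->
    \sum_(j <- r) c j * (\sum_(i < d) (b j 0 i)%:~R * x i) ^+ k = 0.
Proof.
move=> c0 k kN.
pose l (a : 'rV[int]_d) := \sum_(i < d) (a 0 i)%:~R * x i.
suff H (mu : 'I_d -> nat) : (\sum_(i < d) mu i + k <= N)%N ->
    \sum_(j <- r) c j * (mfallz (b j) mu)%:~R * l (b j) ^+ k = 0.
  rewrite -[RHS](H (fun=> 0%N)) ?sum_nat_const ?muln0//.
  by apply: eq_bigr => j _; rewrite mfallz0 mulr1.
elim: k mu {kN} => [|k IH] mu muN.
  rewrite addn0 in muN; rewrite -[RHS](c0 _ muN).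
  by apply: eq_bigr => j _; rewrite mulr1.
have -> : \sum_(j <- r) c j * (mfallz (b j) mu)%:~R * l (b j) ^+ k.+1 =
    \sum_(i < d) x i *
      (\sum_(j <- r) c j * (mfallz (b j) (incr_index mu i))%:~R * l (b j) ^+ k +
       (mu i)%:R * \sum_(j <- r) c j * (mfallz (b j) mu)%:~R * l (b j) ^+ k).
  under [RHS]eq_bigr => i _.
    rewrite mulr_sumr -big_split/= mulr_sumr.
    over.
  rewrite exchange_big/=; apply: eq_bigr => j _.
  rewrite exprS mulrA {1}/l mulr_sumr mulr_suml.
  apply: eq_bigr => i _; rewrite mfallz_incr rmorphM rmorphB/=.
  by rewrite !(mulrDl, mulrDr, mulrN, mulNr); ring.
apply: big1 => i _; rewrite !IH ?mulr0 ?addr0 ?mulr0//.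
  by rewrite (leq_trans _ muN)// leq_add2l.
by rewrite sum_incr_index addSnnS.
Qed.

(** * Derivatives of Laurent polynomials *)

(** Directional derivatives are derivatives along a line, which reduces partial
    derivatives of monomials to one variable. *)
Lemma is_derive_line (K : numFieldType) (V W : normedModType K) (f : V -> W)
    (x v : V) (df : W) :
  is_derive (0 : K) 1 (fun h : K => f (h *: v + x)) df -> is_derive x v f df.
Proof.
move=> [fx <-]; split; first exact: (derivable1P f x v).2.
rewrite /derive; set g1 := fun h => h^-1 *: _; set g2 := fun h => h^-1 *: _.
suff -> : g1 = g2 by [].
by apply/funext => h; rewrite /g1 /g2 /= addr0 scale0r add0r [_%:A]mulr1.
Qed.

Lemma is_derive_inv (K : numFieldType) (V : normedModType K) (f : V -> K)
    (x v : V) (df : K) :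
  f x != 0 -> is_derive x v f df ->
  is_derive x v (fun y => (f y)^-1) (- (f x) ^- 2 * df).
Proof.
by move=> fx0 [dfx <-]; split; [exact: derivableV|exact: deriveV].
Qed.

Lemma is_derive_exprz (K : numFieldType) (b : int) (z : K) : z != 0 ->
  is_derive (0 : K) 1 (fun h : K => (h + z) ^ b) (b%:~R * z ^ (b - 1)).
Proof.
move=> z0.
have dX (n : nat) :
    is_derive (0 : K) 1 (fun h : K => (h + z) ^+ n) (n%:R * z ^+ n.-1).
  have /is_derive_eq : is_derive (0 : K) 1 ((shift z : K -> K) ^+ n)
      ((n%:R * (shift z 0) ^+ n.-1) *: (1 : K)).
    by apply: is_deriveX; exact: is_derive_shift.
  rewrite /= add0r [_ *: 1]mulr1.
  rewrite (_ : (shift z : K -> K) ^+ n = fun h : K => (h + z) ^+ n).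
    by move=> /(_ _ erefl).
  by apply/funext => h; rewrite exprfctE.
case: b => n.
  apply: (is_derive_eq (dX n)); case: n => [|n]; first by rewrite !mul0r.
  by rewrite (_ : n.+1%:Z - 1 = n%:Z)// -addn1 PoszD addrK.
pose f (h : K) := (h + z) ^+ n.+1.
have f0 : f 0 != 0 by rewrite /f add0r expf_neq0.
have -> : (fun h : K => (h + z) ^ Negz n) = (fun h => (f h)^-1).
  by apply/funext => h; rewrite NegzE -exprnN.
apply: (is_derive_eq (is_derive_inv f0 (dX n.+1))).
rewrite /f add0r NegzE -opprD -(PoszD n.+1 1) -exprnN.
rewrite rmorphN/= !mulNr; congr (- _).
rewrite mulrCA; congr (_ * _).
have zn0 : z ^+ n != 0 by rewrite expf_neq0.
by rewrite addn1 !exprS; field; rewrite zn0.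
Qed.

Lemma is_derive_monom (K : numFieldType) (d : nat) (a : 'rV[int]_d)
    (i : 'I_d) (z : 'rV[K]_d) : (forall j, z 0 j != 0) ->
  is_derive z (delta_mx 0 i) (monom a)
    ((a 0 i)%:~R * monom (a - delta_mx 0 i) z).
Proof.
move=> z0; apply: is_derive_line.
pose w := \prod_(j < d | j != i) z 0 j ^ a 0 j.
have -> : (fun h : K => monom a (h *: delta_mx 0 i + z)) =
    w \*: (fun h : K => (h + z 0 i) ^ a 0 i).
  apply/funext => h; rewrite /monom (bigD1 i)//= mulrC; congr (_ * _).
    by apply: eq_bigr => j ji; rewrite !mxE (negbTE ji) mulr0 add0r.
  by rewrite !mxE !eqxx mulr1.
apply: (is_derive_eq (is_deriveZ w (is_derive_exprz (a 0 i) (z0 i)))).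
rewrite [_ *: _]mulrCA; congr (_ * _).
rewrite /monom [RHS](bigD1 i)//= mulrC; congr (_ * _).
  by rewrite !mxE !eqxx.
by apply: eq_bigr => j ji; rewrite !mxE (negbTE ji) subr0.
Qed.

(** The torus (K \ {0})^d is open, so formulas valid on it may be
    differentiated there. *)
Lemma near_coord_neq0 (K : numFieldType) (d : nat) (z : 'rV[K]_d) :
  (forall j, z 0 j != 0) ->
  nbhs z [set w : 'rV[K]_d | forall j, w 0 j != 0].
Proof.
move=> z0.
have cj j : nbhs z [set w : 'rV[K]_d | w 0 j != 0].
  exact: (cvgr_neq0 _ (@coord_continuous K 1 d 0 j z) (z0 j)).
exact: (@filter_forall _ _ (fun j => [set w : 'rV[K]_d | w 0 j != 0])
  (nbhs z) _ cj).
Qed.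

(** The termwise mu-th derivative of the Laurent polynomial with coefficients
    [c]. *)
Definition laurent_deriv (K : numFieldType) (d : nat) (r : seq 'rV[int]_d)
    (c : 'rV[int]_d -> K) (mu : 'I_d -> nat) (z : 'rV[K]_d) : K :=
  \sum_(a <- r) c a * (mfallz a mu)%:~R * monom (a - \row_j (mu j)%:Z) z.

(** Agreement is only asked on the torus: for K = R[i] the symbol and its iterated
    derivatives are only given by this formula where no coordinate vanishes, and
    this form of the hypothesis survives each differentiation. *)
Lemma partial_laurent_deriv (K : numFieldType) (d : nat) (r : seq 'rV[int]_d)
    (c : 'rV[int]_d -> K) (mu : 'I_d -> nat) (i : 'I_d) (f : 'rV[K]_d -> K) :
  (forall z : 'rV[K]_d, (forall j, z 0 j != 0) -> f z = laurent_deriv r c mu z) ->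
  forall z : 'rV[K]_d, (forall j, z 0 j != 0) ->
    partial i f z = laurent_deriv r c (incr_index mu i) z.
Proof.
move=> fE z z0; rewrite /partial.
rewrite (@near_eq_derive _ _ _ f (laurent_deriv r c mu)); last first.
  by apply: filterS (near_coord_neq0 z0) => w; exact: fE.
apply: (@derive_val _ _ _ _ _ _ _ _).
rewrite /laurent_deriv; elim: r {fE} => [|a r IH].
  rewrite big_nil; under eq_fun do rewrite big_nil.
  exact: is_derive_cst.
rewrite big_cons; under eq_fun do rewrite big_cons.
have D := is_derive_monom (a - \row_j (mu j)%:Z) i z0.
apply: (is_derive_eq (is_deriveD (is_deriveZ (c a * (mfallz a mu)%:~R) D) IH)).
congr (_ + _); rewrite mfallz_incr rmorphM/= !mulrA [_ *: _]mulrA !mxE.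
congr (_ * monom _ _); apply/rowP => j; rewrite !mxE /incr_index.
by rewrite PoszD opprD addrA; case: (j == i).
Qed.

Lemma mpartial_laurent (K : numFieldType) (d : nat) (r : seq 'rV[int]_d)
    (c : 'rV[int]_d -> K) (mu : 'I_d -> nat) (z : 'rV[K]_d) :
  (forall j, z 0 j != 0) ->
  mpartial mu (fun w => \sum_(a <- r) c a * monom a w) z =
    laurent_deriv r c mu z.
Proof.
move=> z0; rewrite /mpartial.
set f := fun w : 'rV[K]_d => _.
(* After the coordinates in s have been processed, the j-th index is mu j
   counted once per occurrence of j in s. *)
have H s (w : 'rV[K]_d) : (forall j, w 0 j != 0) ->
    foldr (fun i g => iter (mu i) (partial i) g) f s w =
    laurent_deriv r c (fun j => \sum_(i <- s) mu i * (j == i))%N w.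
  elim: s w => [|i s IH] w w0 /=.
    under [X in laurent_deriv _ _ X]eq_fun do rewrite big_nil.
    rewrite /f /laurent_deriv; apply: eq_bigr => a _.
    rewrite mfallz0 mulr1 (_ : \row__ _ = 0) ?subr0//.
    by apply/rowP => j; rewrite !mxE.
  rewrite (_ : (fun j => _) =
      (fun j => \sum_(i <- s) mu i * (j == i) + mu i * (j == i)))%N; last first.
    by apply/funext => j; rewrite big_cons addnC.
  elim: (mu i) w w0 => [|k IHk] w w0 /=.
    rewrite IH//; congr (laurent_deriv _ _ _ _).
    by apply/funext => j; rewrite mul0n addn0.
  rewrite (partial_laurent_deriv _ IHk)//; congr (laurent_deriv _ _ _ _).
  by apply/funext => j; rewrite /incr_index mulSn -addnA [(k * _ + _)%N]addnC.
rewrite H//; congr (laurent_deriv _ _ _ _); apply/funext => j.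
rewrite big_enum/= (bigD1 j)//= eqxx muln1 big1 ?addn0// => i.
by rewrite eq_sym => /negbTE ->; rewrite muln0.
Qed.

(** * The symbol on the torus *)

(** The bound is global, so the whole space serves as the neighbourhood in the
    limit superior; where the denominator vanishes the quotient is 0. *)
Lemma limsup_at0_lty (R : realType) (d n : nat) (f : 'rV[R]_d -> R) (C : R) :
  0 <= C -> (forall x, f x <= C * enorm x ^+ n) ->
  (limsup_at0 (fun x => f x / enorm x ^+ n)%R < +oo)%E.
Proof.
move=> C0 fC.
apply: (@le_lt_trans _ _ C%:E); last exact: ltry.
apply: (@le_trans _ _ (ereal_sup ((fun x : 'rV[R]_d =>
    (f x / enorm x ^+ n)%:E) @` setT))).
  by apply: ereal_inf_lbound; exists setT => //; exact: filterT.
apply: ge_ereal_sup => _ [x _ <-]; rewrite lee_fin.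
have [->|e0] := eqVneq (enorm x ^+ n) 0; first by rewrite invr0 mulr0.
by rewrite ler_pdivrMr// lt_def e0 exprn_ge0// sqrtr_ge0.
Qed.

Definition dotp (R : realType) (d : nat) (a : 'rV[int]_d) (x : 'rV[R]_d) : R :=
  \sum_(i < d) (a 0 i)%:~R * x 0 i.

Lemma ler_norm_dotp (R : realType) (d : nat) (a : 'rV[int]_d) (x : 'rV[R]_d) :
  `|dotp a x| <= (\sum_(i < d) `|(a 0 i)%:~R|) * enorm x.
Proof.
rewrite (le_trans (ler_norm_sum _ _ _))// mulr_suml ler_sum// => i _.
rewrite normrM ler_wpM2l// /enorm -sqrtr_sqr ler_wsqrtr//.
by rewrite (bigD1 i)//= lerDl sumr_ge0// => j _; exact: sqr_ge0.
Qed.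

Lemma monom_expi (R : realType) (d : nat) (a : 'rV[int]_d) (x : 'rV[R]_d) :
  monom a (\row_i expi (x 0 i)) = expi (dotp a x).
Proof.
by rewrite /monom expi_sum; apply: eq_bigr => i _; rewrite mxE expiXz.
Qed.

Lemma dotpN (R : realType) (d : nat) (a : 'rV[int]_d) (x : 'rV[R]_d) :
  dotp a (- x) = - dotp a x.
Proof. by rewrite -sumrN; apply: eq_bigr => i _; rewrite mxE mulrN. Qed.

Lemma trig_symbolE (R : realType) (d : nat)
    (p : {fsfun 'rV[int]_d -> R with 0}) (x : 'rV[R]_d) :
  trig_symbol p x = \sum_(a <- finsupp p) (p a)%:C * expi (- dotp a x).
Proof.
apply: eq_bigr => a _; congr (_ * _).
rewrite (_ : \row_i _ = \row_i expi ((- x) 0 i)); last first.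
  by apply/rowP => i; rewrite !mxE.
by rewrite monom_expi dotpN.
Qed.

Lemma dotpD (R : realType) (d : nat) (a : 'rV[int]_d) (x y : 'rV[R]_d) :
  dotp a (x + y) = dotp a x + dotp a y.
Proof. by rewrite -big_split; apply: eq_bigr => i _; rewrite mxE mulrDr. Qed.

Lemma dotp0 (R : realType) (d : nat) (x : 'rV[R]_d) : dotp 0 x = 0.
Proof. by apply: big1 => i _; rewrite mxE mul0r. Qed.

Lemma monomB (K : numFieldType) (d : nat) (a b : 'rV[int]_d) (z : 'rV[K]_d) :
  (forall j, z 0 j != 0) -> monom (a - b) z = monom a z / monom b z.
Proof.
move=> z0; rewrite /monom -prodf_div; apply: eq_bigr => i _.
by rewrite !mxE expfzDr// -invr_expz.
Qed.

Lemma monom_neq0 (K : numFieldType) (d : nat) (a : 'rV[int]_d) (z : 'rV[K]_d) :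
  (forall j, z 0 j != 0) -> monom a z != 0.
Proof. by move=> z0; apply/prodf_neq0 => i _; exact: expfz_neq0. Qed.

(** Multiplying D^mu p(z) by z^mu turns the factor z^(a - mu) of each term into
    z^a, which no longer depends on mu. *)
Lemma mfallz_moments_eq0 (R : realType) (d : nat)
    (p : {fsfun 'rV[int]_d -> R with 0}) (z : 'rV[R[i]]_d)
    (mu : 'I_d -> nat) :
  (forall j, z 0 j != 0) -> mpartial mu (symbol p) z = 0 ->
  \sum_(a <- finsupp p) (p a)%:C * monom a z * (mfallz a mu)%:~R = 0.
Proof.
move=> z0; rewrite (mpartial_laurent _ (fun a => (p a)%:C))// => pz.
set nu := \row_j (mu j)%:Z.
transitivity (monom nu z * laurent_deriv (finsupp p) (fun a => (p a)%:C) mu z).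
  rewrite mulr_sumr; apply: eq_bigr => a _.
  by rewrite monomB//; field; exact: monom_neq0.
by rewrite pz mulr0.
Qed.

(** Separates the nontrivial points of E_M from the all-ones point, through
    1 - cos (2 pi t) = 2 sin^2 (pi t). *)
Lemma expi_neq1 (R : realType) (t : R) :
  0 < t < 1 -> expi (- (2 * pi * t)) != 1.
Proof.
move=> /andP[t0 t1]; apply/eqP => /(congr1 (@complex.Re R))/=.
rewrite cosN (_ : 2 * pi * t = pi * t + pi * t); last by ring.
rewrite cosD => c1.
have : sin (pi * t) ^+ 2 = 0 by have := cos2Dsin2 (pi * t); nra.
apply/eqP; rewrite expf_neq0// gt_eqF// sin_gt0_pi// mulr_gt0 ?pi_gt0//=.
by rewrite -[ltRHS]mulr1 ltr_pM2l ?pi_gt0.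
Qed.

Lemma symbol_const1 (R : realType) (d : nat)
    (p : {fsfun 'rV[int]_d -> R with 0}) :
  symbol p (const_mx 1) = \sum_(a <- finsupp p) (p a)%:C.
Proof.
apply: eq_bigr => a _; rewrite /monom big1 ?mulr1// => i _.
by rewrite mxE exp1rz.
Qed.

Lemma det_dilation (d : nat) (m : 'I_d -> nat) :
  \det (dilation m) = (\prod_(i < d) m i)%N :> int.
Proof.
rewrite det_diag -natz natr_prod; apply: eq_bigr => i _.
by rewrite !mxE natz.
Qed.

(** The exponents are indexed by an arbitrary type, so that a constant term can be
    added to a sum in which the exponent 0 may already occur. *)
Lemma exp_sum_bigO (R : realType) (d n : nat) (I : Type) (r : seq I)
    (b : I -> 'rV[int]_d) (c : I -> R[i]) :
  (forall mu : 'I_d -> nat, (\sum_(i < d) mu i < n)%N ->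
     \sum_(j <- r) c j * (mfallz (b j) mu)%:~R = 0) ->
  exists2 C : R, 0 <= C & forall x : 'rV[R]_d,
    normc (\sum_(j <- r) c j * expi (- dotp (b j) x)) <= C * enorm x ^+ n.
Proof.
move=> c0.
have nc_ge0 (z : R[i]) : 0 <= normc z by case: z => x y; exact: sqrtr_ge0.
pose w (a : 'rV[int]_d) : R := \sum_(i < d) `|(a 0 i)%:~R|.
have w_ge0 a : 0 <= w a by apply: sumr_ge0.
exists ((\sum_(j <- r) normc (c j) * w (b j) ^+ n) *+ 2).
  by rewrite mulrn_wge0// sumr_ge0// => j _; rewrite mulr_ge0// exprn_ge0.
move=> x; apply: (le_trans (normc_exp_sum_le (n := n) _)) => [k kn|].
  case: n c0 kn => // N c0 kN.
  rewrite -[RHS](@moments_eq0 _ d N I r b c (fun i => (- x 0 i)%:C) _ k kN)//.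
  apply: eq_bigr => j _; congr (_ * _ ^+ _).
  rewrite /dotp -sumrN rmorph_sum; apply: eq_bigr => i _ /=.
  by rewrite -mulrN rmorphM/= rmorph_int.
rewrite mulrnAl lerMn2r/= mulr_suml; apply: ler_sum => j _.
rewrite -mulrA ler_wpM2l// -exprMn normrN lerXn2r// ?nnegrE ?mulr_ge0//.
  exact: sqrtr_ge0.
exact: ler_norm_dotp.
Qed.

Theorem theorem5p1 (R : realType) (d q : nat) (m : 'I_d -> nat)
    (p : {fsfun 'rV[int]_d -> R with 0})
    (hd : (0 < d)%N) (hq : (0 < q)%N) (hm : forall i, (2 <= m i)%N)
    (hder : forall (eps : 'rV[R[i]]_d) (mu : 'I_d -> nat),
       E_M m eps -> eps != const_mx 1 ->
       (\sum_(i < d) mu i <= 2 * q - 1)%N ->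
       mpartial mu (symbol p) eps = 0)
    (hone : symbol p (const_mx 1) = (`|\det (dilation m)|%:~R : R)%:C) :
  (forall y : 'rV[rat]_d, y != 0 ->
     (forall i, exists2 k : nat, (k < m i)%N & y 0 i = k%:R / (m i)%:R) ->
     (limsup_at0 (fun x : 'rV[R]_d =>
        Normc.normc (trig_symbol p (x + (2 * pi) *: map_mx ratr y))
          / enorm x ^+ (2 * q))%R < +oo)%E) /\
  (limsup_at0 (fun x : 'rV[R]_d =>
     Normc.normc (trig_symbol p x - (\prod_(i < d) m i)%:R) / enorm x)%R
   < +oo)%E.
Proof.
split.
- move=> y y0 /fin_all_exists2 [g gm yE].
  pose eps : 'rV[R[i]]_d :=
    \row_i expi ((- ((2 * pi) *: map_mx ratr y)) 0 i).
  have epsE i : eps 0 i = expi (- (2 * pi * ((g i)%:R / (m i)%:R))).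
    by rewrite !mxE yE fmorph_div/= !ratr_nat.
  have eps_neq0 i : eps 0 i != 0 by rewrite epsE expi_neq0.
  have epsEM : E_M m eps.
    by exists g => //; apply/rowP => i; rewrite epsE mxE mulrA.
  have eps_neq1 : eps != const_mx 1.
    have [i yi0] : exists i, y 0 i != 0.
      apply/existsP; rewrite -negb_forall; apply: contra y0 => /forallP y0.
      by apply/eqP/rowP => i; rewrite mxE; apply/eqP.
    apply/eqP => /rowP/(_ i)/eqP; rewrite epsE mxE; apply/negP.
    have m0 : 0 < (m i)%:R :> R by rewrite ltr0n (leq_trans _ (hm i)).
    apply: expi_neq1; rewrite ltr_pdivrMr// mul1r ltr_nat gm andbT.
    rewrite divr_gt0// ltr0n lt0n; apply: contra yi0 => /eqP g0.
    by rewrite yE g0 mul0r.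
  have [mu muq|C C0 hC] := @exp_sum_bigO R d (2 * q) _ (finsupp p) id
      (fun a => (p a)%:C * monom a eps) _.
    apply: mfallz_moments_eq0 => //; apply: hder => //.
    by rewrite -ltnS subn1 prednK// muln_gt0.
  apply: (limsup_at0_lty C0) => x.
  suff -> : trig_symbol p (x + (2 * pi) *: map_mx ratr y) =
      \sum_(a <- finsupp p) (p a)%:C * monom a eps * expi (- dotp a x).
    exact: hC.
  rewrite trig_symbolE; apply: eq_bigr => a _.
  by rewrite monom_expi dotpN -mulrA -expiD dotpD opprD addrC.
(* The constant is put first as a term of exponent 0; only mu = 0 is below 1. *)
- have [mu|C C0 hC] := @exp_sum_bigO R d 1 _
      ((0, - symbol p (const_mx 1)) :: [seq (a, (p a)%:C) | a <- finsupp p])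
      fst snd _.
    rewrite ltnS leqn0 sum_nat_eq0 => /forallP mu0.
    rewrite (_ : mu = fun=> 0%N); last by apply/funext => i; exact/eqP/mu0.
    under eq_bigr => j _ do rewrite mfallz0 mulr1.
    by rewrite big_cons big_map/= symbol_const1 addNr.
  apply: (limsup_at0_lty (n := 1) C0) => x.
  suff -> : trig_symbol p x - (\prod_(i < d) m i)%:R =
      \sum_(j <- (0, - symbol p (const_mx 1)) ::
                [seq (a, (p a)%:C) | a <- finsupp p])
        j.2 * expi (- dotp j.1 x).
    exact: hC.
  rewrite big_cons big_map/= trig_symbolE addrC hone det_dilation dotp0.
  by rewrite oppr0 expi0 mulr1 ger0_norm// rmorph_int.
Qed.
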